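(* Let $t_{n,k}$ denote the number of permutations of $\{1,\ldots,n\}$ with $k$ components. The following equalities hold for $n\ge2$: $$t_{n,1}=n!+(-1)^{n-1}+\sum_{k=1}^{n-2}(-1)^k\sum_{j=1}^{n-k-1}\binom{k+1}{j}(n-k-1+j)!\sum_{\substack{s_1,\ldots,s_j\ge2\\ s_1+\cdots+s_j=n-k-1+j}}\frac{1}{\binom{n-k-1+j}{s_1,\ldots,s_j}};$$ for $2\le k\le n-1$, $$t_{n,k}=\binom{n-1}{k-1}(-1)^{n-k}+\sum_{r=k-1}^{n-2}\binom{r}{k-1}(-1)^{r-k+1}\sum_{j=1}^{n-r-1}\binom{r+1}{j}(n-r-1+j)!\sum_{\substack{s_1,\ldots,s_j\ge2\\ s_1+\cdots+s_j=n-r-1+j}}\frac{1}{\binom{n-r-1+j}{s_1,\ldots,s_j}};$$ and $$t_{n,n}=1.$$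
   Context: A permutation is indecomposable if its one-line notation cannot be split into two (nonempty) parts such that every number in the first part is smaller than every number in the second part; the number of components of a permutation is the number of blocks in its finest splitting into consecutive parts such that every number in an earlier part is smaller than every number in a later part. The numbers $t_{n,k}$ ($n\ge1$, $k\ge 1$; $t_{n,k}=0$ if $n<k$) satisfy $t_{n,1}=n!-\sum_{j=1}^{n-1}(n-j)!\,t_{j,1}$ and $t_{n,k}=\sum_{j=1}^{n-k+1}t_{j,1}\,t_{n-j,k-1}$ for $2\le k\le n$. $\binom{m}{s_1,\ldots,s_j}=\frac{m!}{s_1!\cdots s_j!}$ is the multinomial coefficient; the $s_i$ are integers; empty sums are $0$. *)

(* Defs.v *)
From HB Require Import structures.
From mathcomp Require Import all_boot all_order all_algebra all_fingroup.

Set Implicit Arguments.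
Unset Strict Implicit.
Unset Printing Implicit Defensive.

Import Order.TTheory GRing.Theory Num.Theory.

(* A permutation of {1, ..., n} is s : 'S_n: its one-line notation is the word
   s 0, ..., s (n - 1), and a part of this word is given by its set of
   positions A : {set 'I_n}. *)

Definition consecutive (n : nat) (A : {set 'I_n}) : bool :=
  [forall i in A, forall k in A, forall j : 'I_n,
    (i <= j <= k)%N ==> (j \in A)].

Definition earlier (n : nat) (A B : {set 'I_n}) : bool :=
  [forall i in A, forall j in B, (i < j)%N].

Definition smaller (n : nat) (s : 'S_n) (A B : {set 'I_n}) : bool :=
  [forall i in A, forall j in B, (s i < s j)%N].

Definition splitting (n : nat) (s : 'S_n) (P : {set {set 'I_n}}) : bool :=
  [&& partition P [set: 'I_n],
      [forall A in P, consecutive A]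
    & [forall A in P, forall B in P, earlier A B ==> smaller s A B]].

Definition finer (n : nat) (P Q : {set {set 'I_n}}) : bool :=
  [forall A in P, exists B in Q, A \subset B].

Definition finest_splitting (n : nat) (s : 'S_n) (P : {set {set 'I_n}}) :
    bool :=
  splitting s P && [forall Q : {set {set 'I_n}}, splitting s Q ==> finer P Q].

Definition has_components (n : nat) (s : 'S_n) (k : nat) : bool :=
  [exists P : {set {set 'I_n}}, finest_splitting s P && (#|P| == k)].

Definition t (n k : nat) : nat := #|[set s : 'S_n | has_components s k]|.

Local Open Scope ring_scope.

Definition multinomial (m j : nat) (s : 'I_j -> nat) : rat :=
  (m`!)%:R / \prod_(i < j) ((s i)`!)%:R.

(* The parts s i of a sum equal to m are at most m, so that the index set of
   all (s_1, ..., s_j) with s_i >= 2 and s_1 + ... + s_j = m is covered by the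
   finite type {ffun 'I_j -> 'I_m.+1}. *)
Definition inv_multinomial_sum (m j : nat) : rat :=
  \sum_(s : {ffun 'I_j -> 'I_m.+1}
        | [forall i, (2 <= s i)%N] && ((\sum_(i < j) s i)%N == m))
    (multinomial m (fun i => s i : nat))^-1.

(* Main.v *)
(* Write F = sum_(i >= 1) i! x^i. The components of a permutation s of
   {0, ..., n - 1} are delimited by its cuts, the c such that s preserves
   {0, ..., c - 1}; if d of them satisfy 0 < c < n, then s has d + 1 components.
   Removing the part of s before the first of r chosen cuts gives, by
   induction, sum_s C(d(s), r) = [x^n] F^(r + 1). Binomial inversion yields
   t_{n,k} = sum_r (-1)^(r - k + 1) C(r, k - 1) [x^n] F^(r + 1), and the
   formulas follow by expanding F^(r + 1) with F = x + G, as
   [x^m] G^j = m! * inv_multinomial_sum m j. *)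
Require Import Defs.
From HB Require Import structures.
From mathcomp Require Import all_boot all_order all_algebra all_fingroup.
From mathcomp Require Import zify.

Set Implicit Arguments.
Unset Strict Implicit.
Unset Printing Implicit Defensive.

Import Order.TTheory GRing.Theory Num.Theory.

Local Open Scope ring_scope.

(** * Truncated factorial series and sums of inverse multinomials *)

(** Modulo [X^N] this is the series F for [l = 1] and G for [l = 2]; a general [l] lets the lowest
    terms be split off one at a time. *)
Definition factorial_poly (N l : nat) : {poly rat} :=
  \sum_(l <= i < N) (i`!)%:R *: 'X^i.

Lemma factorial_polyS (N l : nat) : (l < N)%N ->
  factorial_poly N l = (l`!)%:R *: 'X^l + factorial_poly N l.+1.
Proof. by move=> ltlN; rewrite /factorial_poly big_ltn. Qed.

Lemma coef_factorial_polyM_lt (N l i : nat) (q : {poly rat}) : (i < l)%N ->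
  (factorial_poly N l * q)`_i = 0.
Proof.
move=> ltil; rewrite mulr_suml coef_sum big_nat big1 // => j /andP[lej _].
by rewrite -scalerAl coefZ coefXnM (leq_trans ltil lej) mulr0.
Qed.

Lemma coef_factorial_polyM (N l m : nat) (q : {poly rat}) : (l < N)%N ->
  (factorial_poly N l * q)`_(m + l) =
    (l`!)%:R * q`_m + (factorial_poly N l.+1 * q)`_(m + l).
Proof.
move=> ltlN; rewrite factorial_polyS // mulrDl coefD -scalerAl coefZ coefXnM.
by rewrite ltnNge leq_addl addnK.
Qed.

Lemma coef_factorial_polyX_lt (N l j i : nat) : (i < l * j)%N ->
  (factorial_poly N l ^+ j)`_i = 0.
Proof.
elim: j i => [|j IHj] i; first by rewrite muln0.
rewrite mulnS => lti;
  rewrite exprS mulr_suml coef_sum big_nat big1 // => k /andP[lek _].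
rewrite -scalerAl coefZ coefXnM; case: ltnP => leki; rewrite ?mulr0 //.
by rewrite IHj ?mulr0 //; lia.
Qed.

Lemma factorial_polyE (N l : nat) :
  factorial_poly N l = \poly_(i < N) (if (l <= i)%N then (i`!)%:R else 0).
Proof.
rewrite /factorial_poly (@big_nat_widenl _ _ _ l 0) //= big_mkord poly_def.
by rewrite big_mkcond; apply: eq_bigr => i _; case: ifP => _; rewrite ?scale0r.
Qed.

Lemma coef_expr_trunc (R : nzSemiRingType) (m j : nat) (p q : {poly R}) :
    (forall i, (i <= m)%N -> p`_i = q`_i) ->
  forall i, (i <= m)%N -> (p ^+ j)`_i = (q ^+ j)`_i.
Proof.
move=> eqpq; elim: j => [|j IHj] i leim; first by rewrite !expr0.
rewrite !exprS !coefM; apply: eq_bigr => k _.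
by rewrite eqpq ?IHj //; have := ltn_ord k; lia.
Qed.

(** Choosing one term from each of the [j] factors contributes the product of the [(s i)!], which is
    [m!] over the multinomial coefficient. *)
Lemma inv_multinomial_sumE (N m j : nat) : (m < N)%N ->
  (m`!)%:R * inv_multinomial_sum m j = (factorial_poly N 2 ^+ j)`_m.
Proof.
move=> ltmN.
(* Truncation at [m.+1] makes the exponents range over ['I_m.+1], as in [inv_multinomial_sum]. *)
transitivity ((factorial_poly m.+1 2 ^+ j)`_m); last first.
  apply: (@coef_expr_trunc _ m) => // i leim.
  by rewrite !factorial_polyE !coef_poly ltnS leim (leq_ltn_trans leim ltmN).
pose w i : rat := if (2 <= i)%N then (i`!)%:R else 0.
rewrite factorial_polyE poly_def -[in RHS](card_ord j) -prodr_const.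
rewrite bigA_distr_bigA coef_sum /inv_multinomial_sum mulr_sumr.
rewrite [LHS]big_mkcond /=; apply: eq_bigr => f _.
transitivity ((\prod_i w (f i)) * (m == (\sum_i f i)%N)%:R); last first.
  by rewrite scaler_prod prodrXr coefZ coefXn.
case: ifP => [/andP[/forallP le2f /eqP ->]|/negbT].
  rewrite eqxx mulr1 /multinomial invf_div mulrC divfK ?pnatr_eq0 -?lt0n
    ?fact_gt0 //.
  by apply: eq_bigr => i _; rewrite /w le2f.
rewrite negb_and eq_sym; case: eqP;
  rewrite ?mulr0 // orbF => _ /forallPn[i lti].
by rewrite (bigD1 i) //= /w (negbTE lti) !mul0r.
Qed.

(** * Changes of summation range and binomial inversion *)

Lemma eq_sum_nat_support (V : nmodType) (a b c d : nat) (F : nat -> V) :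
    (forall i, (a <= i < b)%N != (c <= i < d)%N -> F i = 0) ->
  \sum_(a <= i < b) F i = \sum_(c <= i < d) F i.
Proof.
move=> F0; pose M := maxn b d.
have E x y : (y <= M)%N ->
    \sum_(x <= i < y) F i = \sum_(0 <= i < M) if (x <= i < y)%N then F i else 0.
  move=> leyM; rewrite (big_nat_widen _ _ M) // (@big_nat_widenl _ _ _ x 0) //.
  by rewrite big_mkcond; apply: eq_bigr => i _ /=; rewrite andbC.
rewrite !E ?leq_maxl ?leq_maxr //; apply: eq_bigr => i _.
by move: (F0 i); case: (a <= i < b)%N; case: (c <= i < d)%N => // ->.
Qed.

(* Compare the coefficients of X^p in X^d = (1 + (X - 1))^d. *)
Lemma signed_bin_inversion (n d p : nat) : (d < n)%N ->
  \sum_(p <= r < n) 'C(r, p)%:R * (-1) ^+ (r - p) * 'C(d, r)%:R =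
    (d == p)%:R :> rat.
Proof.
move=> ltdn.
have coefXB1 r : (('X - 1) ^+ r : {poly rat})`_p = 'C(r, p)%:R * (-1) ^+ (r -
  p).
  have E i : (-1) ^+ i = ((-1) ^+ i)%:P :> {poly rat} by rewrite rmorph_sign.
  rewrite exprBn coef_sum.
  case: (leqP p r) => lepr; last first.
    rewrite bin_small // mul0r big1 // => i _.
    rewrite coefMn expr1n mulr1 E coefCM coefXn.
    have -> : (p == r - i)%N = false by lia.
    by rewrite mulr0 mul0rn.
  (* Only the index [r - p] of the expansion produces [X^p]. *)
  have lt : (r - p < r.+1)%N by lia.
  rewrite (bigD1 (Ordinal lt)) //= big1 ?addr0 => [|i neq].
    rewrite coefMn expr1n mulr1 E coefCM coefXn subKn // eqxx.
    by rewrite mulr1 bin_sub // mulr_natl.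
  rewrite coefMn expr1n mulr1 E coefCM coefXn.
  have := ltn_ord i; move: neq; rewrite -val_eqE /= => neq lti.
  have -> : (p == r - i)%N = false by lia.
  by rewrite mulr0 mul0rn.
have := congr1 (fun q : {poly rat} => q`_p) (exprDn 1 ('X - 1 : {poly rat}) d).
rewrite /= addrC subrK coefXn coef_sum eq_sym => ->.
rewrite (eq_bigr (fun r : 'I_d.+1 => 'C(r, p)%:R * (-1) ^+ (r - p) * 'C(d,
  r)%:R)); last first.
  by move=> r _; rewrite expr1n mul1r coefMn coefXB1 mulr_natr.
rewrite -(big_mkord xpredT (fun r => 'C(r, p)%:R * (-1) ^+ (r - p) * 'C(d,
  r)%:R)).
(* Where the two ranges differ, one of the binomial coefficients vanishes. *)
apply: eq_sum_nat_support => r neq.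
case: (ltnP r p) => [ltrp|lepr]; first by rewrite bin_small ?mul0r.
by rewrite (@bin_small d) ?mulr0 //; lia.
Qed.

(** * Coefficients of the powers of F *)

(** Let [d = n - r - 1]. Taking G from [j] of the [r + 1] factors X + G leaves the coefficient of
    [X^(d + j)] in G^j, which vanishes for [j > d] since G^j has order [2 * j]. The bound on [N]
    covers the degrees [d + j <= 2 * d]. *)
Lemma coef_factorial_poly1X (N n r : nat) : (2 * n < N)%N -> (r < n)%N ->
  (factorial_poly N 1 ^+ r.+1)`_n = (r == n - 1)%N%:R +
    \sum_(1 <= j < (n - r - 1).+1) 'C(r + 1, j)%:R * ((n - r - 1 + j)`!)%:R *
      inv_multinomial_sum (n - r - 1 + j) j.
Proof.
move=> ltnN ltrn; set d := (n - r - 1)%N.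
pose F j : rat := 'C(r + 1, j)%:R * (factorial_poly N 2 ^+ j)`_(d + j).
have Flt j : (d < j)%N -> F j = 0.
  by move=> ltdj; rewrite /F coef_factorial_polyX_lt ?mulr0 //; lia.
have Flarge j : (r.+1 < j)%N -> F j = 0.
  by move=> ltrj; rewrite /F bin_small ?mul0r //; lia.
transitivity (\sum_(0 <= j < r.+2) F j).
  rewrite factorial_polyS ?scale1r ?expr1; last by lia.
  rewrite exprDn coef_sum big_mkord; apply: eq_bigr => j _.
  have := ltn_ord j; rewrite ltnS => lej.
  rewrite coefMn coefXnM ltnNge.
  have -> : (r.+1 - j <= n)%N by lia.
  have -> : (n - (r.+1 - j) = d + j)%N by rewrite /d; lia.
  by rewrite /F mulr_natl addn1.
rewrite (@eq_sum_nat_support _ 0 r.+2 0 d.+1); last first.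
  by move=> j neq; case: (ltnP d j) => ?; [rewrite Flt | rewrite Flarge] => //;
    lia.
(* The term [j = 0] is the coefficient of [X^d] in 1, nonzero only if [d = 0], that is
   [r = n - 1]. *)
rewrite big_ltn // {1}/F bin0 mul1r expr0 coef1 addn0.
congr (_ + _); first by congr (_%:R); lia.
rewrite big_nat [RHS]big_nat; apply: eq_bigr => j /andP[j_gt0 lejd].
by rewrite /F -(@inv_multinomial_sumE N) ?mulrA //; lia.
Qed.

(** * Cuts and the factorization of permutations at a cut *)

Definition itv (n a b : nat) : {set 'I_n} := [set x : 'I_n | (a <= x < b)%N].

Lemma card_itv (n a b : nat) : (b <= n)%N -> #|itv n a b| = (b - a)%N.
Proof.
move=> lebn; rewrite cardsE -sum1_card big_mkcond /=.
rewrite -(big_mkord xpredT (fun i => if (a <= i < b)%N then 1%N else 0%N)).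
rewrite (@eq_sum_nat_support _ 0 n a b) => [|i].
  rewrite big_nat (eq_bigr (fun=> 1%N)) => [|i ->] //.
  by rewrite -big_nat sum_nat_const_nat muln1.
by case: ifP => // /andP[_ ltib]; rewrite (leq_trans ltib lebn).
Qed.

Definition cut (n : nat) (s : 'S_n) (c : nat) : bool :=
  [forall x : 'I_n, (x < c)%N ==> (s x < c)%N].

(** An injection of the positions below [c] into themselves is onto, so no other position is mapped
    below [c]. *)
Lemma cutE (n : nat) (s : 'S_n) (c : nat) :
  cut s c -> forall x : 'I_n, (s x < c)%N = (x < c)%N.
Proof.
move=> /forallP cs x; pose A := [set y : 'I_n | (y < c)%N].
have sA : s @: A = A.
  apply/eqP; rewrite eqEcard card_imset ?leqnn ?andbT; last exact: perm_inj.
  apply/subsetP => y /imsetP[z]; rewrite inE => ltzc ->.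
  by rewrite inE; exact: (implyP (cs z)).
have := mem_imset A x (@perm_inj _ s).
by rewrite sA !inE.
Qed.

Lemma cutM (n : nat) (s1 s2 : 'S_n) (c : nat) :
  cut s1 c -> cut (s1 * s2)%g c = cut s2 c.
Proof.
move=> c1; apply/forallP/forallP => c2 x; last first.
  by rewrite permM -(cutE c1); exact: c2.
by have := c2 (s1^-1 x)%g; rewrite permM permKV -(cutE c1) permKV.
Qed.

Lemma perm_on_itv_cut (n a b c : nat) (s : 'S_n) :
  (b <= c)%N -> perm_on (itv n a b) s -> cut s c.
Proof.
move=> lebc sP; apply/forallP => x; apply/implyP => ltxc.
have [xI|xI] := boolP (x \in itv n a b); last by rewrite (out_perm sP).
by move: xI; rewrite -(perm_closed _ sP) inE => /andP[_ /leq_trans]; apply.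
Qed.

(** Supplies the condition under which [restr_perm] agrees with [s] on the interval. *)
Lemma perm_on_cut_astabs (n a c : nat) (s : 'S_n) :
  perm_on (itv n a n) s -> cut s c -> s \in 'N(itv n a c | 'P)%g.
Proof.
move=> sP cs; apply/astabsP => x; rewrite /= apermE !inE (cutE cs).
by have := perm_closed x sP; rewrite !inE !ltn_ord !andbT => ->.
Qed.

(** A permutation of [[a, n)] with cut [c] factors uniquely into permutations of [[a, c)] and
    [[c, n)]; the first factor is its restriction to [[a, c)]. *)
Lemma sum_perm_on_cut (V : nmodType) (n a c : nat) (F : 'S_n -> V) :
    (a <= c)%N ->
  \sum_(s | perm_on (itv n a n) s && cut s c) F s =
  \sum_(s1 | perm_on (itv n a c) s1)
    \sum_(s2 | perm_on (itv n c n) s2) F (s1 * s2)%g.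
Proof.
move=> leac; rewrite pair_big /=.
pose split_at s := (restr_perm (itv n a c) s, (restr_perm (itv n a c) s)^-1 *
  s)%g.
rewrite (reindex_onto (fun p : 'S_n * 'S_n => p.1 * p.2)%g split_at) /=;
  last first.
  by move=> s _; rewrite mulKVg.
apply: eq_bigl => -[s1 s2] /=; apply/idP/idP.
  have : s2 = (s1^-1 * (s1 * s2))%g by rewrite mulKg.
  set s := (s1 * s2)%g => def2 /andP[/andP[sP cs] /eqP[def1 _]].
  have s1P : perm_on (itv n a c) s1 by rewrite -def1 restr_perm_on.
  (* [s2] fixes every [x < c]: below [a] both [s1] and [s] fix [x], and on [[a, c)] the permutation
     [s] agrees with [s1]. *)
  rewrite s1P; apply/subsetP => x; apply: contraR;
    rewrite !inE ltn_ord andbT -ltnNge => ltxc.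
  have [leax|ltxa] := leqP a x; last first.
    have fixx s' b : perm_on (itv n a b) s' -> s' x = x.
      by move=> s'P; rewrite (out_perm s'P) // inE leqNgt ltxa.
    by rewrite def2 permM (fixx _ _ (perm_onV s1P)) (fixx _ _ sP).
  have xI : (s1^-1 x)%g \in itv n a c.
    by rewrite (perm_closed _ (perm_onV s1P)) inE leax.
  rewrite def2 permM -(restr_permE (perm_on_cut_astabs sP cs) xI) def1.
  by rewrite permKV.
move=> /andP[s1P s2P].
have sP : perm_on (itv n a n) (s1 * s2)%g.
  apply: perm_onM.
    apply: subset_trans s1P _; apply/subsetP => x.
    by rewrite !inE ltn_ord andbT => /andP[].
  apply: subset_trans s2P _; apply/subsetP => x.
  by rewrite !inE ltn_ord !andbT; exact: leq_trans.
have cs : cut (s1 * s2)%g c.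
  rewrite (cutM _ (perm_on_itv_cut (leqnn c) s1P)).
  apply/forallP => x; apply/implyP => ltxc.
  by rewrite (out_perm s2P) // inE leqNgt ltxc.
rewrite sP cs /= /split_at.
suff -> : restr_perm (itv n a c) (s1 * s2)%g = s1 by rewrite mulKg eqxx.
apply/permP => x; have [xI|xI] := boolP (x \in itv n a c); last first.
  by rewrite (out_perm s1P) // (out_perm (restr_perm_on _ _)).
rewrite restr_permE ?perm_on_cut_astabs // permM (out_perm s2P) //.
by move: xI; rewrite -(perm_closed _ s1P) !inE => /andP[_];
  rewrite ltnNge => /negbTE->.
Qed.

(** * Binomial moments of the number of cuts *)

(** For [m = n - 1] these are all cuts strictly between 0 and [n]; a smaller [m] keeps those that
    the induction has still to examine. *)
Definition num_cuts (n : nat) (s : 'S_n) (m : nat) : nat :=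
  \sum_(n - m <= c < n) cut s c.

Lemma num_cutsS (n : nat) (s : 'S_n) (m : nat) : (m < n)%N ->
  num_cuts s m.+1 = (cut s (n - m.+1) + num_cuts s m)%N.
Proof.
by move=> ltmn; rewrite /num_cuts big_ltn -?subSn ?subSS //; lia.
Qed.

(* The induction on m decides whether n - m is a chosen cut; l is the number of
   points between the last chosen cut (the start of the support of s) and the
   positions n - m, ..., n - 1 still to be examined. *)
Lemma sum_bin_num_cuts (N n m l r : nat) :
    (n < N)%N -> (0 < l)%N -> (m + l <= n)%N ->
  \sum_(s : 'S_n | perm_on (itv n (n - (m + l)) n) s) 'C(num_cuts s m, r)%:R =
    (factorial_poly N l * factorial_poly N 1 ^+ r)`_(m + l).
Proof.
move=> ltnN; elim: m l r => [|m IHm] l r l_gt0 lemn.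
  rewrite coef_factorial_polyM ?coef_factorial_polyM_lt ?addr0 //; last by lia.
  rewrite (eq_bigr (fun=> 'C(0, r)%:R)); last first.
    by move=> s _; rewrite /num_cuts subn0 big_geq.
  rewrite (eq_bigl (mem (perm_on (itv n (n - l) n)))) // sumr_const card_perm.
  rewrite card_itv // subKn // mulr_natl; congr (_ *+ _).
  case: r => [|r]; first by rewrite expr0 coef1.
  by rewrite exprS coef_factorial_polyM_lt.
have lemn' : (m + l.+1 <= n)%N by lia.
rewrite coef_factorial_polyM ?addSnnS; last by lia.
rewrite -[in RHS]IHm //.
case: r => [|r].
  rewrite expr0 coef1 mulr0 add0r.
  by apply: eq_bigr => s _; rewrite !bin0.
set A := itv n _ n; pose c := (n - m.+1)%N.
(* Pascal's rule when [c] is a cut: the first sum leaves [c] unchosen, the second chooses it. *)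
transitivity (\sum_(s : 'S_n | perm_on A s) 'C(num_cuts s m, r.+1)%:R +
   \sum_(s : 'S_n | perm_on A s && cut s c) 'C(num_cuts s m, r)%:R : rat).
  rewrite [X in _ + X]big_mkcondr -big_split /=; apply: eq_bigr => s _.
  rewrite num_cutsS -/c; last by lia.
  by case: ifP; rewrite ?add0n ?addr0 // add1n binS natrD.
rewrite addrC; congr (_ + _).
rewrite sum_perm_on_cut; last by rewrite /c; lia.
(* There are [l!] permutations before the chosen cut; after it the count restarts with [l = 1]. *)
rewrite (eq_bigr (fun=> (factorial_poly N 1 ^+ r.+1)`_m.+1)).
  rewrite (eq_bigl (mem (perm_on (itv n (n - (m + l.+1)) c)))) // sumr_const.
  rewrite card_perm card_itv ?leq_subr // mulr_natl; congr (_ *+ _`!).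
  by rewrite /c; lia.
move=> s1 s1P; rewrite exprS -[m.+1]addn1 -IHm //; last by lia.
rewrite /c addn1; apply: eq_bigr => s2 _; congr ('C(_, _)%:R).
rewrite /num_cuts big_nat [RHS]big_nat; apply: eq_bigr => d /andP[led _].
by rewrite (cutM _ (perm_on_itv_cut _ s1P)) //; lia.
Qed.

(** * Cuts and splittings *)

Lemma ltn_across_cut (n : nat) (s : 'S_n) (c : nat) (i j : 'I_n) :
  cut s c -> (i < c)%N -> (c <= j)%N -> (s i < s j)%N.
Proof.
move=> cs ltic lecj; have := cutE cs i; have := cutE cs j.
by rewrite ltic [(j < c)%N]ltnNge lecj ltnNge => /negbFE lecsj /leq_trans;
  apply.
Qed.

(** Pigeonhole: if [i < c <= s i], the [n - c] positions from [c] on would all need values above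
    [s i], and fewer than [n - c] exist. *)
Lemma cut_of_ltn (n : nat) (s : 'S_n) (c : nat) : (c <= n)%N ->
    (forall i j : 'I_n, (i < c)%N -> (c <= j)%N -> (s i < s j)%N) ->
  cut s c.
Proof.
move=> lecn lts; apply/forallP => i; apply/implyP => ltic.
rewrite ltnNge; apply/negP => lecsi.
have : s @: itv n c n \subset itv n (s i).+1 n.
  apply/subsetP => v /imsetP[j]; rewrite !inE => /andP[lecj _] ->.
  by rewrite ltn_ord andbT; exact: lts.
move/subset_leq_card; rewrite card_imset ?card_itv //; last exact: perm_inj.
by have := ltn_ord (s i); lia.
Qed.

(** A block A of P lies in a block B of Q, which lies in a block C of P; A is nonempty and blocks of
    P are disjoint, so A = C and hence A = B. *)
Lemma partition_finer_anti (n : nat) (P Q : {set {set 'I_n}}) (D : {set 'I_n}) :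
  partition P D -> partition Q D -> finer P Q -> finer Q P -> P = Q.
Proof.
have sub P' Q' : partition P' D -> finer P' Q' -> finer Q' P' -> P' \subset Q'.
  move=> /and3P[_ /trivIsetP tP P0] /'forall_in_exists_inP PQ
    /'forall_in_exists_inP QP.
  apply/subsetP => A AP; have [B BQ sAB] := PQ _ AP; have [C CP sBC] := QP _ BQ.
  suff eqAC : A = C by have -> : A = B by apply/eqP; rewrite eqEsubset sAB eqAC.
  apply/eqP/negPn/negP => /(tP _ _ AP CP).
  rewrite -setI_eq0 (setIidPl (subset_trans sAB sBC)) => /eqP A0.
  by rewrite -A0 AP in P0.
by move=> pP pQ PQ QP; apply/eqP; rewrite eqEsubset !sub.
Qed.

(** The cut is the least position after [x] outside the block of [x]. *)
Lemma splitting_cut (n : nat) (s : 'S_n) (Q : {set {set 'I_n}}) (x y : 'I_n) :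
    splitting s Q -> (x <= y)%N -> pblock Q x != pblock Q y ->
  exists c : 'I_n, [&& cut s c, x < c & c <= y]%N.
Proof.
move=> /and3P[/and3P[/eqP covQ tQ _] /forall_inP consQ /forall_inP incQ] lexy
  neq.
have covE z : z \in cover Q by rewrite covQ inE.
have blockE z z' : z' \in pblock Q z -> pblock Q z = pblock Q z'.
  by move=> z'z; apply/eqP; rewrite eq_pblock.
have convQ (z i j k : 'I_n) : i \in pblock Q z -> k \in pblock Q z -> (i <= j
  <= k)%N ->
    j \in pblock Q z.
  move=> iz kz; have /forall_inP/(_ _ iz) := consQ _ (pblock_mem (covE z)).
  by move=> /forall_inP/(_ _ kz)/forallP/(_ j)/implyP.
have selfQ z : z \in pblock Q z by rewrite mem_pblock.
have Py : (x < y)%N && (y \notin pblock Q x).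
  rewrite -eq_pblock // neq andbT ltn_neqAle lexy andbT.
  by apply: contraNneq neq => /val_inj ->.
have [c /andP[ltxc cNx] cmin] := @arg_minnP _ y
  (fun c : 'I_n => (x < c)%N && (c \notin pblock Q x)) (fun c => c : nat) Py.
exists c; rewrite ltxc (cmin _ Py) !andbT.
apply: cut_of_ltn => [|i j ltic lecj]; first exact: ltnW.
(* A common block would contain [c.-1] and [c]. Either [c.-1] is [x] or minimality puts it in the
   block of [x], which would then contain [c]. *)
have neqij : pblock Q i != pblock Q j.
  apply: contraNneq cNx => eqij.
  have ji : j \in pblock Q i by rewrite eqij.
  have ltpn : (c.-1 < n)%N by have := ltn_ord c; lia.
  pose p := Ordinal ltpn.
  have pi : p \in pblock Q i by apply: (convQ i i _ j) => //=; lia.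
  have ci : c \in pblock Q i by apply: (convQ i i _ j) => //=; lia.
  suff px : p \in pblock Q x by rewrite (blockE _ _ px) -(blockE _ _ pi).
  have [ltxp|lepx] := ltnP x p; last first.
    by have -> : p = x by apply: val_inj; move: lepx => /=; lia.
  apply/negPn/negP => pNx; have := cmin p; rewrite ltxp pNx => /(_ isT) /=.
  by lia.
have ltij : (i < j)%N := leq_trans ltic lecj.
have := incQ _ (pblock_mem (covE i)) => /forall_inP/(_ _ (pblock_mem (covE j))).
move=> /implyP ear; suff /ear/forall_inP/(_ _ (selfQ i)) :
    earlier (pblock Q i) (pblock Q j).
  by move=> /forall_inP/(_ _ (selfQ j)).
apply/forall_inP => i' i'i; apply/forall_inP => j' j'j.
(* If [j' <= i'], convexity puts [i] in the block of [j] when [j' <= i], and [j'] in the block of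
   [i] otherwise. *)
rewrite ltnNge; apply: contra neqij => lej'i'; rewrite eq_pblock //.
have [lej'i|ltij'] := leqP j' i.
  have ij : i \in pblock Q j by apply: (convQ j j' _ j);
    rewrite // lej'i (ltnW ltij).
  by rewrite -(blockE _ _ ij).
have j'i : j' \in pblock Q i by apply: (convQ i i _ i');
  rewrite // lej'i' (ltnW ltij').
by rewrite (blockE _ _ j'i) -(blockE _ _ j'j).
Qed.

(** * The finest splitting *)

(** The default [ord0] is admissible because 0 is always a cut. *)
Definition block_start (n : nat) (s : 'S_n.+1) (x : 'I_n.+1) : 'I_n.+1 :=
  [arg max_(c > ord0 | cut s c && (c <= x)%N) (c : nat)]%N.

Lemma block_startP (n : nat) (s : 'S_n.+1) (x : 'I_n.+1) :
  [/\ cut s (block_start s x), (block_start s x <= x)%N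
    & forall c : 'I_n.+1, cut s c -> (c <= x)%N -> (c <= block_start s x)%N].
Proof.
rewrite /block_start; case: arg_maxnP => [|c /andP[cs lecx] cmax].
  by rewrite leq0n andbT; apply/forallP.
by split=> // d ds ledx; apply: cmax; rewrite ds.
Qed.

Lemma block_start_homo (n : nat) (s : 'S_n.+1) (x y : 'I_n.+1) :
  (x <= y)%N -> (block_start s x <= block_start s y)%N.
Proof.
move=> lexy; have [cs lex _] := block_startP s x.
by have [_ _] := block_startP s y; apply=> //; exact: leq_trans lexy.
Qed.

Definition component_partition (n : nat) (s : 'S_n.+1) : {set {set 'I_n.+1}} :=
  preim_partition (block_start s) [set: 'I_n.+1].

(** The cuts are the fixed points of [block_start], and each block is the fibre over its first
    position. *)
Lemma card_component_partition (n : nat) (s : 'S_n.+1) :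
  #|component_partition s| = #|[set c : 'I_n.+1 | cut s c]|.
Proof.
pose fib c := [set y in [set: 'I_n.+1] | c == block_start s y].
have start_cut (c : 'I_n.+1) : cut s c -> block_start s c = c.
  move=> cs; apply/val_inj/eqP; rewrite eqn_leq.
  by have [_ -> ->] := block_startP s c.
have -> : component_partition s = fib @: [set c : 'I_n.+1 | cut s c].
  apply/setP => A; apply/imsetP/imsetP => -[x xP ->].
    by exists (block_start s x); rewrite // inE; case: (block_startP s x).
  by exists x => //; rewrite inE in xP; rewrite start_cut.
apply: card_in_imset => c d; rewrite !inE => cs ds /setP/(_ c).
by rewrite !inE !start_cut // eqxx => /esym/eqP.
Qed.

(** Blocks are consecutive by monotonicity of [block_start]. For [i], [j] in an earlier and a later
    block, the start of the block of [j] is a cut separating them; otherwise both blocks contain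
    [j], forcing [j < j]. *)
Lemma component_partition_splitting (n : nat) (s : 'S_n.+1) :
  splitting s (component_partition s).
Proof.
apply/and3P; split; first exact: preim_partitionP.
  apply/forall_inP => _ /imsetP[z _ ->]; apply/forall_inP => i;
    rewrite !inE => /eqP zi.
  apply/forall_inP => k; rewrite !inE => /eqP zk.
  apply/forallP => j; apply/implyP => /andP[leij lejk];
    rewrite !inE -val_eqE eqn_leq.
  by rewrite {1}zi zk !block_start_homo.
apply/forall_inP => _ /imsetP[x _ ->]; apply/forall_inP => _ /imsetP[y _ ->].
apply/implyP => /forall_inP ear.
apply/forall_inP => i iA; apply/forall_inP => j jB.
have := iA; have := jB; rewrite !inE => /eqP yj /eqP xi.
have /forall_inP/(_ _ jB) ltij := ear _ iA.
have [cs lecj cmax] := block_startP s j.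
apply: (ltn_across_cut cs) => //; rewrite ltnNge; apply/negP => leci.
have eqij : block_start s i = block_start s j.
  apply/val_inj/eqP; rewrite eqn_leq (block_start_homo _ (ltnW ltij)) /=.
  by have [_ _] := block_startP s i; apply.
have jA : j \in [set y0 in [set: 'I_n.+1] | block_start s x == block_start s
  y0].
  by rewrite !inE xi eqij eqxx.
by have /forall_inP/(_ _ jB) := ear _ jA; rewrite ltnn.
Qed.

(** Two positions in different blocks of [Q] have a cut between them, hence different values of
    [block_start]. *)
Lemma component_partition_finest (n : nat) (s : 'S_n.+1) (Q : {set {set
  'I_n.+1}}) :
  splitting s Q -> finer (component_partition s) Q.
Proof.
move=> sQ; have /and3P[/and3P[/eqP covQ tQ _] _ _] := sQ.
have covE z : z \in cover Q by rewrite covQ inE.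
apply/'forall_in_exists_inP => _ /imsetP[x _ ->].
exists (pblock Q x); first exact: pblock_mem.
have same (u v : 'I_n.+1) : (u <= v)%N -> block_start s u = block_start s v ->
    pblock Q u = pblock Q v.
  move=> leuv eqs; apply/eqP/negPn/negP => /(splitting_cut sQ leuv)[c].
  move=> /and3P[cs ltuc lecv]; have [_ _ /(_ _ cs lecv)] := block_startP s v.
  by have [_ + _] := block_startP s u; rewrite eqs; lia.
apply/subsetP => y; rewrite !inE => /eqP eqs; rewrite -eq_pblock //; apply/eqP.
by case: (leqP x y) => [/same->|/ltnW/same->].
Qed.

Lemma has_componentsE (n : nat) (s : 'S_n.+1) (k : nat) :
  has_components s k = ((num_cuts s n).+1 == k).
Proof.
have -> : (num_cuts s n).+1 = #|component_partition s|.
  rewrite card_component_partition cardsE -sum1_card big_mkcond /=.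
  rewrite -(big_mkord xpredT (fun c => if cut s c then 1%N else 0%N)) /=.
  (* The cut 0 accounts for the successor. *)
  rewrite big_ltn // /num_cuts subSnn.
  have -> : cut s 0 by apply/forallP.
  by rewrite add1n; congr _.+1; apply: eq_bigr => c _; case: cut.
have sP := component_partition_splitting s.
apply/existsP/idP => [[P /andP[/andP[sP' /forallP finP] /eqP <-]]|cardP].
  have -> // : component_partition s = P.
  have [[pP _] [pP' _]] := (andP sP, andP sP').
  apply: partition_finer_anti pP pP' (component_partition_finest sP') _.
  exact: implyP (finP _) sP.
exists (component_partition s); rewrite cardP andbT /finest_splitting sP.
by apply/forallP => Q; apply/implyP/component_partition_finest.
Qed.

(** * The formulas for [t] *)

Lemma num_cuts_leq (n : nat) (s : 'S_n) (m : nat) : (num_cuts s m <= m)%N.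
Proof.
apply: leq_trans (_ : \sum_(n - m <= c < n) 1 <= m)%N.
  by apply: leq_sum => c _; exact: leq_b1.
by rewrite sum_nat_const_nat muln1; lia.
Qed.

Lemma t_coef (N n k : nat) : (0 < n < N)%N -> (0 < k)%N ->
  (t n k)%:R = \sum_(k - 1 <= r < n) 'C(r, k - 1)%:R * (-1) ^+ (r + 1 - k) *
    (factorial_poly N 1 ^+ r.+1)`_n.
Proof.
case: n => [|n] // /andP[_ ltnN]; case: k => [|k] // _; rewrite subn1 /=.
transitivity (\sum_(s : 'S_n.+1) (num_cuts s n == k)%:R : rat).
  rewrite /t -sum1_card natr_sum big_mkcond /=; apply: eq_bigr => s _.
  by rewrite inE has_componentsE eqSS; case: eqP.
rewrite (eq_bigr (fun s => \sum_(k <= r < n.+1)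
    'C(r, k)%:R * (-1) ^+ (r - k) * 'C(num_cuts s n, r)%:R)); last first.
  by move=> s _; rewrite signed_bin_inversion // ltnS num_cuts_leq.
rewrite exchange_big; apply: eq_bigr => r _ /=.
rewrite -mulr_sumr addn1 subSS exprS -[in RHS](addn1 n); congr (_ * _).
(* With [m = n] and [l = 1] the support is all of ['I_n.+1], so every permutation is counted. *)
rewrite -(@sum_bin_num_cuts N n.+1) ?addn1 // subnn; apply: eq_bigl => s.
by apply/esym/subsetP => x _; rewrite inE ltn_ord.
Qed.

Theorem corollary4p1 (n : nat) (hn : (2 <= n)%N) :
  [/\ (t n 1)%:R = (n`!)%:R + (-1) ^+ (n - 1)
        + \sum_(1 <= k < (n - 2).+1) (-1) ^+ k *
            \sum_(1 <= j < (n - k - 1).+1)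
              'C(k + 1, j)%:R * ((n - k - 1 + j)`!)%:R *
              inv_multinomial_sum (n - k - 1 + j) j :> rat,
      forall k : nat, (2 <= k <= n - 1)%N ->
        (t n k)%:R = 'C(n - 1, k - 1)%:R * (-1) ^+ (n - k)
          + \sum_(k - 1 <= r < (n - 2).+1)
              'C(r, k - 1)%:R * (-1) ^+ (r + 1 - k) *
              \sum_(1 <= j < (n - r - 1).+1)
                'C(r + 1, j)%:R * ((n - r - 1 + j)`!)%:R *
                inv_multinomial_sum (n - r - 1 + j) j :> rat
    & t n n = 1%N].
Proof.
pose N := (2 * n).+1; pose u r : rat := (factorial_poly N 1 ^+ r.+1)`_n.
have tE k : (0 < k)%N -> (t n k)%:R = \sum_(k - 1 <= r < n)
    'C(r, k - 1)%:R * (-1) ^+ (r + 1 - k) * u r.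
  by move=> k_gt0; apply: t_coef => //; rewrite /N; lia.
have def_n : n = (n - 2).+2 by lia.
(* This value yields the isolated term of the formula for [k < n], and the whole sum for [k = n]. *)
have u_last : u (n - 1)%N = 1.
  rewrite /u coef_factorial_poly1X ?eqxx //; try lia.
  by rewrite big_geq ?addr0 //; lia.
have u_small r : (r < (n - 2).+1)%N -> u r = \sum_(1 <= j < (n - r - 1).+1)
    'C(r + 1, j)%:R * ((n - r - 1 + j)`!)%:R * inv_multinomial_sum (n - r - 1 +
      j) j.
  move=> ltr; rewrite /u coef_factorial_poly1X //; try lia.
  have -> : (r == n - 1)%N = false by lia.
  by rewrite add0r.
have tE' k : (0 < k < n)%N -> (t n k)%:R = 'C(n - 1, k - 1)%:R * (-1) ^+ (n - k)
    + \sum_(k - 1 <= r < (n - 2).+1) 'C(r, k - 1)%:R * (-1) ^+ (r + 1 - k) * u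
      r.
  move=> /andP[k_gt0 ltkn]; rewrite tE // [in X in \sum_(_ <= _ < X) _]def_n.
  rewrite big_nat_recr /=; last by lia.
  have -> : (n - 2).+1 = (n - 1)%N by lia.
  by rewrite u_last mulr1 addrC subnK; last by lia.
split.
- rewrite tE'; last by lia.
  rewrite subnn big_ltn; last by lia.
  (* For [k = 1] the term [r = 0] is the coefficient of F itself and is left unexpanded. *)
  have -> : u 0%N = (n`!)%:R.
    by rewrite /u expr1 factorial_polyE coef_poly ltnS leq_pmull // ltnW.
  rewrite !bin0 !mul1r addrCA addrA.
  congr (_ + _); rewrite big_nat [RHS]big_nat; apply: eq_bigr => r /andP[_ ltr].
  by rewrite bin0 mul1r addnK u_small.
- move=> k k_bounds; rewrite tE'; last by lia.
  congr (_ + _); rewrite big_nat [RHS]big_nat; apply: eq_bigr => r /andP[_ ltr].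
  by rewrite u_small.
- apply/eqP; rewrite -(eqr_nat rat) tE; last by lia.
  rewrite -{2}(subnK (ltnW hn)) addn1 big_nat1 u_last binn subnK ?subnn ?mulr1
    //.
  exact: ltnW.
Qed.
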